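(* For every integer $k$ such that $k-1$ is a prime power, there exist infinitely many connected bipartite $k$-regular graphs $G$ with $\sqrt{k-2}-1<R(G)<\sqrt{k-1}-1$.
   Context: All graphs are simple. For a graph $G$ of order $n$ with adjacency eigenvalues $\lambda_1\geqslant\cdots\geqslant\lambda_n$, the HL-index is $R(G)=\max\{|\lambda_{\lfloor (n+1)/2\rfloor}|,\ |\lambda_{\lceil (n+1)/2\rceil}|\}$. *)

(* Defs.v *)
From HB Require Import structures.
From mathcomp Require Import all_boot all_order all_algebra all_field.
Set Implicit Arguments. Unset Strict Implicit. Unset Printing Implicit Defensive.
Import Order.TTheory GRing.Theory Num.Theory.
Local Open Scope ring_scope.

Definition simple_graph n (e : rel 'I_n) : Prop :=
  (forall i j, e i j = e j i) /\ (forall i, ~~ e i i).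

Definition connected_graph n (e : rel 'I_n) : Prop :=
  forall i j, connect e i j.

Definition bipartite_graph n (e : rel 'I_n) : Prop :=
  exists c : 'I_n -> bool, forall i j, e i j -> c i != c j.

Definition regular_graph n (k : nat) (e : rel 'I_n) : Prop :=
  forall i, #|[pred j | e i j]| = k.

Definition prime_power (q : nat) : Prop :=
  exists p m : nat, [/\ prime p, (0 < m)%N & q = (p ^ m)%N].

Definition adjmx n (e : rel 'I_n) : 'M[algC]_n := \matrix_(i, j) (e i j)%:R.

Definition spectrum_of n (A : 'M[algC]_n) (s : seq algC) : Prop :=
  [/\ size s = n, all (fun x => x \is Num.real) s,
      sorted (fun x y => y <= x) s &
      char_poly A = \prod_(x <- s) ('X - x%:P)].

(* HL-index: max(|lambda_{floor((n+1)/2)}|, |lambda_{ceil((n+1)/2)}|), 1-based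
   indices converted to 0-based nth. *)
Definition HL_index (n : nat) (s : seq algC) : algC :=
  Num.max `|nth 0 s ((n.+1)./2).-1| `|nth 0 s ((n.+2)./2).-1|.

(* Main.v *)
Require Import Defs.
From HB Require Import structures.
From mathcomp Require Import all_boot all_order all_algebra all_field.
From mathcomp Require Import ring.
Import Order.TTheory GRing.Theory Num.Theory.
Local Open Scope ring_scope.
Local Open Scope sesquilinear_scope.

(* Take q = k - 1 and the point-line incidence graph of the projective plane of
   order q, and lift it to a cyclic cover of even length with a nontrivial voltage on
   a single edge. If B is the incidence matrix of the lift, the HL-index is the least
   singular value of B. On each sheet the plane alone contributes
   q |x|^2 + (sum x)^2 to |x B|^2, and the shifted edge perturbs this by
   - (a + b)^2 + (a' + b)^2, where a, a' are the values of x at the special line on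
   the sheet and its predecessor, and b is the sum of x over the other lines through
   the special point. A sum-of-squares certificate gives |x B|^2 >= (q - D) |x|^2
   for some D < 2 sqrt (q - 1), while a vector alternating in sign from sheet to
   sheet gives |x B|^2 < (q + 1 - 2 sqrt q) |x|^2; note that
   q - 2 sqrt (q - 1) = (sqrt (q - 1) - 1)^2 and q + 1 - 2 sqrt q = (sqrt q - 1)^2. *)

(** * Squared norms and characteristic polynomials *)

Definition sqnorm {n} (v : 'rV[algC]_n) : algC := \sum_j `|v 0 j| ^+ 2.

Lemma sqnormE {n} (v : 'rV[algC]_n) : sqnorm v = (v *m v^t*) 0 0.
Proof.
by rewrite mxE; apply: eq_bigr => j _; rewrite !mxE normCK.
Qed.

Lemma sqnorm_unitary {n} (v : 'rV[algC]_n) (P : 'M[algC]_n) :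
  P \is unitarymx -> sqnorm (v *m P) = sqnorm v.
Proof.
move=> /unitarymxP PP.
by rewrite !sqnormE trmx_mul map_mxM mulmxA -(mulmxA v) PP mulmx1.
Qed.

Lemma char_poly_conj n (P Q A : 'M[algC]_n) :
  P *m Q = 1%:M -> char_poly (P *m A *m Q) = char_poly A.
Proof.
move=> PQ; rewrite /char_poly /char_poly_mx.
have PQ' : map_mx polyC P *m map_mx polyC Q = 1%:M by rewrite -map_mxM PQ map_mx1.
have -> : 'X%:M - map_mx polyC (P *m A *m Q) =
   map_mx polyC P *m ('X%:M - map_mx polyC A) *m map_mx polyC Q.
  rewrite mulmxBr mulmxBl !map_mxM; congr (_ - _).
  by rewrite scalar_mxC -mulmxA PQ' mulmx1.
by rewrite !det_mulmx mulrAC -det_mulmx PQ' det1 mul1r.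
Qed.

Lemma char_poly_diag n (d : 'rV[algC]_n) :
  char_poly (diag_mx d) = \prod_(x <- [seq d 0 i | i <- enum 'I_n]) ('X - x%:P).
Proof.
rewrite char_poly_trig ?diag_mx_is_trig // big_map big_enum /=.
by apply: eq_bigr => i _; rewrite mxE eqxx.
Qed.

(** * HL-index of a bipartite graph from bounds on its quadratic form *)

Lemma sorted_ge_nth (s : seq algC) i j : sorted (fun x y => y <= x) s ->
  (i <= j)%N -> (j < size s)%N -> nth 0 s j <= nth 0 s i.
Proof.
move=> ss ij js; apply: (sorted_leq_nth _ _ 0 ss); rewrite ?inE //.
- by move=> x y z /= xy yz; apply: le_trans yz xy.
- exact: leq_ltn_trans ij js.
Qed.

(* A multiset of reals invariant under negation and listed in decreasing order
   satisfies [s_(n-1-i) = - s_i], so the two middle terms are opposite and have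
   the least absolute value. *)
Lemma HL_index_symmetric (n M : nat) (s : seq algC) :
  n = M.*2 -> (0 < M)%N -> size s = n -> all (fun x => x \is Num.real) s ->
  sorted (fun x y => y <= x) s -> perm_eq s (map -%R s) ->
  HL_index n s \in map Num.norm s /\ (forall x, x \in s -> HL_index n s <= `|x|).
Proof.
move=> En M0 ss sr srt sym.
(* Negating and reversing yields a decreasing list of the same multiset, hence the same list. *)
have Es : s = rev (map -%R s).
  apply: (@sorted_eq_in _ (fun x y => y <= x)) => //.
  - by move=> x y z _ _ _ /= xy yz; apply: le_trans yz xy.
  - by move=> x y _ _ /= /andP[xy yx]; apply/eqP; rewrite eq_le yx xy.
  - rewrite rev_sorted sorted_map; apply: sub_sorted srt => x y /= yx.
    by rewrite lerN2.
  - by rewrite (perm_trans sym) // perm_sym perm_rev.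
have nthN i : (i < n)%N -> nth 0 s i = - nth 0 s (n - i.+1).
  move=> ni; rewrite {1}Es nth_rev size_map ss //.
  by rewrite (nth_map 0) // ss ltn_subrL (leq_ltn_trans _ ni).
have M1 : (M.-1 < n)%N by rewrite En -addnn; case: M M0 {En} => //= m _; rewrite addSn ltnS leq_addr.
have Mn : (M < n)%N by rewrite En -addnn -{1}(addn0 M) ltn_add2l.
have mid : nth 0 s M.-1 = - nth 0 s M.
  by rewrite nthN // prednK // En -addnn addnK.
have E1 : (n.+1)./2.-1 = M.-1 by rewrite En /= uphalf_double.
have E2 : (n.+2)./2.-1 = M by rewrite En /= half_double.
have EH : HL_index n s = `|nth 0 s M| by rewrite /HL_index E1 E2 mid normrN maxxx.
have pos : 0 <= nth 0 s M.-1.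
  have : nth 0 s M <= nth 0 s M.-1 by apply: sorted_ge_nth; rewrite ?leq_pred ?ss.
  rewrite -[nth 0 s M]opprK -mid -subr_ge0 opprK -mulr2n pmulrn_lge0 //.
have EH' : HL_index n s = nth 0 s M.-1.
  by rewrite EH -normrN -mid ger0_norm.
split; first by rewrite EH map_f // mem_nth // ss.
move=> x /(nthP 0)[i]; rewrite ss => ni <-; rewrite EH'.
case: (ltnP i M) => iM.
  have h : nth 0 s M.-1 <= nth 0 s i.
    by apply: sorted_ge_nth; rewrite ?ss // -ltnS prednK.
  by rewrite (ger0_norm (le_trans pos h)).
have h : nth 0 s i <= nth 0 s M by apply: sorted_ge_nth; rewrite ?ss.
have h' : nth 0 s M.-1 <= - nth 0 s i by rewrite mid lerN2.
by rewrite -normrN (ger0_norm (le_trans pos h')).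
Qed.

(** The colouring makes the spectrum symmetric, so the HL-index is the least absolute value of an
    eigenvalue, and its square is the minimum of [sqnorm (v *m adjmx e) / sqnorm v]. The two form
    bounds therefore enclose it. *)
Lemma adjmx_spectrum n M (e : rel 'I_n) (c : 'I_n -> bool) (al be : algC) :
  n = M.*2 -> (0 < M)%N ->
  (forall i j, e i j = e j i) -> (forall i j, e i j -> c i != c j) ->
  (forall v : 'rV_n, al * sqnorm v <= sqnorm (v *m adjmx e)) ->
  be \is Num.real ->
  (exists v : 'rV_n, sqnorm (v *m adjmx e) < be * sqnorm v) ->
  exists s, [/\ spectrum_of (adjmx e) s, 0 <= HL_index n s,
     al <= HL_index n s ^+ 2 & HL_index n s ^+ 2 < be].
Proof.
move=> En M0 sym bip lo rbe [w hi]; set A := adjmx e.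
have Aherm : A \is hermsymmx.
  apply: realsym_hermsym.
    apply/is_hermitianmxP; rewrite expr0 scale1r.
    by apply/matrixP => i j; rewrite !mxE sym.
  by apply/mxOverP => i j; rewrite mxE realn.
have /hermitian_normalmx/orthomx_spectralP := Aherm.
have := hermitian_spectral_diag_real Aherm.
have := spectral_unitarymx A.
move: (spectralmx A) (spectral_diag A) => P d Pu dr.
rewrite invmx_unitary // => AE.
have PP : P *m P^t* = 1%:M by apply/unitarymxP.
have PP' : P^t* *m P = 1%:M by apply: mulmx1C.
have P'u : P^t* \is unitarymx by rewrite trmxC_unitary.
have dreal i : d 0 i \is Num.real by apply/mxOverP.
pose s0 := [seq d 0 i | i <- enum 'I_n].
pose s := sort (fun x y => y <= x) s0.
have pss0 : perm_eq s s0 by rewrite perm_sort.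
have s0r : all (fun x => x \is Num.real) s0.
  by apply/allP => x /mapP[i _ ->].
have cpA : char_poly A = \prod_(x <- s0) ('X - x%:P).
  by rewrite {1}AE char_poly_conj // char_poly_diag.
have mems x : (x \in s) = (x \in s0) by exact: perm_mem.
have [ss sr ssrt] : [/\ size s = n, all (fun x => x \is Num.real) s &
    sorted (fun x y => y <= x) s].
  split; first by rewrite size_sort size_map size_enum_ord.
    by rewrite (perm_all _ pss0).
  (* The order of [algC] is total only on the reals, so sorting relies on the eigenvalues being
     real. *)
  apply: (sort_sorted_in (P := fun x => x \is Num.real)) => //.
  by move=> x y xr yr; apply: real_leVge.
have spec : spectrum_of A s by split=> //; rewrite cpA; apply: perm_big; rewrite perm_sym.
have sym_s : perm_eq s (map -%R s).
  have : perm_eq s0 (map -%R s0).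
    apply: prod_XsubC_eq; rewrite -cpA.
    (* Conjugation by the signs of the colouring turns [A] into [- A], because every edge joins
       opposite signs. *)
    pose D : 'M[algC]_n := diag_mx (\row_i (-1) ^+ c i).
    have DD : D *m D = 1%:M.
      apply/matrixP => i j; rewrite mul_diag_mx !mxE.
      case: eqP => [->|_]; last by rewrite mulr0n mulr0.
      by rewrite mulr1n -expr2 sqrr_sign.
    have DAD : D *m A *m D = - A.
      apply/matrixP => i j; rewrite mul_mx_diag mul_diag_mx !mxE.
      case: (boolP (e i j)) => [/bip|_]; last by rewrite !(mulr0, mul0r) oppr0.
      by case: (c i) (c j) => [] [] //= _; rewrite ?(expr0, expr1, mulr1, mul1r).
    rewrite -(char_poly_conj n D D A DD) DAD AE.
    have -> : - (P^t* *m diag_mx d *m P) = P^t* *m diag_mx (- d) *m P.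
      by rewrite -mulNmx -mulmxN -raddfN.
    rewrite char_poly_conj // char_poly_diag.
    suff -> : map -%R s0 = [seq (- d) 0 i | i <- enum 'I_n] by [].
    by rewrite -map_comp; apply: eq_map => i; rewrite /= !mxE.
  move=> h; rewrite (perm_trans pss0) // (perm_trans h) // perm_sym.
  exact: perm_map.
have [inH minH] := HL_index_symmetric n M s En M0 ss sr ssrt sym_s.
exists s; split=> //.
- by have /mapP[x _ ->] := inH.
- have /mapP[x] := inH; rewrite mems => /mapP[i _ ->] ->.
  (* Row [i] of [P] is a unit eigenvector for [d 0 i]; there [lo] reads [al <= |d 0 i| ^ 2]. *)
  have uE : sqnorm (row i P) = 1.
    by rewrite rowE sqnorm_unitary // /sqnorm (bigD1 i) //= big1 ?mxE ?eqxx
       ?normr1 ?expr1n ?addr0 // => j ji; rewrite mxE (negPf ji) andbF normr0 expr0n.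
  have := lo (row i P); rewrite uE mulr1 => h; apply: le_trans h _.
  rewrite -/A AE !mulmxA sqnorm_unitary // -row_mul PP /sqnorm mul_mx_diag.
  rewrite (bigD1 i) //= big1 ?mxE ?eqxx ?mul1r ?addr0 // => j ji.
  by rewrite !mxE eq_sym (negPf ji) mul0r normr0 expr0n.
(* If every squared eigenvalue were at least [be], writing [w] in the eigenbasis would contradict
   [hi]. *)
- have [i di] : exists i, `|d 0 i| ^+ 2 < be.
    case: (pickP (fun i => `|d 0 i| ^+ 2 < be)) => [i hi'|no]; first by exists i.
    move: hi; rewrite -/A AE !mulmxA sqnorm_unitary // -(sqnorm_unitary w _ P'u).
    move: (w *m P^t*) => u; rewrite le_gtF //.
    rewrite /sqnorm mul_mx_diag mulr_sumr; apply: ler_sum => j _.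
    rewrite !mxE normrM exprMn mulrC ler_wpM2l ?exprn_ge0 //.
    by rewrite real_leNgt ?realX ?normr_real // no.
  apply: le_lt_trans di.
  rewrite lerXn2r ?nnegrE //.
    by have /mapP[x _ ->] := inH.
  by apply: minH; rewrite mems map_f // mem_enum.
Qed.

Lemma reindex_enum_val (V : finType) (F : 'I_#|V| -> algC) :
  \sum_i F i = \sum_v F (enum_rank v).
Proof. by apply: reindex; exists enum_val => ? _; rewrite ?enum_valK ?enum_rankK. Qed.

(** Transport to ordinals along [enum_rank]. Real test functions suffice: adjacency entries are
    real, so the real and imaginary parts of a vector contribute separately to both squared
    norms. *)
Lemma graph_spectrum (V : finType) (E : rel V) (c : V -> bool) (k M : nat)
    (al be : algC) :
  #|V| = M.*2 -> (0 < M)%N ->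
  (forall u v, E u v = E v u) -> (forall u v, E u v -> c u != c v) ->
  (forall u v, connect E u v) -> (forall u, #|[pred v | E u v]| = k) ->
  (forall x : V -> algC, (forall v, x v \is Num.real) ->
    al * (\sum_v x v ^+ 2) <= \sum_v (\sum_u x u * (E u v)%:R) ^+ 2) ->
  be \is Num.real ->
  (exists2 x : V -> algC, forall v, x v \is Num.real &
    \sum_v (\sum_u x u * (E u v)%:R) ^+ 2 < be * (\sum_v x v ^+ 2)) ->
  exists e : rel 'I_#|V|, [/\ simple_graph e, connected_graph e,
    bipartite_graph e, regular_graph k e &
    exists s, [/\ spectrum_of (adjmx e) s, 0 <= HL_index #|V| s,
      al <= HL_index #|V| s ^+ 2 & HL_index #|V| s ^+ 2 < be]].
Proof.
move=> cV M0 symE bipE conE regE lo rbe [w wr hi].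
pose e : rel 'I_#|V| := fun i j => E (enum_val i) (enum_val j).
have sym_e i j : e i j = e j i by rewrite /e symE.
have bip_e i j : e i j -> c (enum_val i) != c (enum_val j) by apply: bipE.
have sqA (x : V -> algC) (xr : forall v, x v \is Num.real) (v : 'rV_#|V|) :
    (forall i, v 0 i = x (enum_val i)) ->
    sqnorm v = \sum_v x v ^+ 2 /\
    sqnorm (v *m adjmx e) = \sum_v (\sum_u x u * (E u v)%:R) ^+ 2.
  move=> vE; rewrite /sqnorm !reindex_enum_val; split; apply: eq_bigr => u _.
    by rewrite vE enum_rankK real_normK.
  rewrite mxE reindex_enum_val.
  have -> : \sum_v0 v 0 (enum_rank v0) * adjmx e (enum_rank v0) (enum_rank u) =
            \sum_u0 x u0 * (E u0 u)%:R.
    by apply: eq_bigr => z _; rewrite vE mxE /e !enum_rankK.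
  by rewrite real_normK // rpred_sum // => z _; rewrite realM // realn.
exists e; split.
- by split=> // i; apply/negP => /bip_e; rewrite eqxx.
- move=> i j; have /connectP[p pp Ep] := conE (enum_val i) (enum_val j).
  apply/connectP; exists (map enum_rank p).
    rewrite -[i]enum_valK path_map; apply: sub_path pp => u v /=.
    by rewrite /e !enum_rankK.
  by rewrite -[i]enum_valK last_map -Ep enum_valK.
- by exists (fun i => c (enum_val i)).
- move=> i; rewrite -(regE (enum_val i)).
  rewrite -[RHS](card_imset _ enum_rank_inj).
  apply: eq_card => j; rewrite !inE; apply/idP/imsetP => [eij|[v ev ->]].
    by exists (enum_val j); rewrite ?enum_valK.
  by move: ev; rewrite !inE /e enum_rankK.
- apply: (adjmx_spectrum #|V| M e (fun i => c (enum_val i))) => //; last first.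
    exists (\row_i w (enum_val i)).
    by have [|-> ->] := sqA w wr (\row_i w (enum_val i)); first by move=> i; rewrite mxE.
  move=> v; pose a u := 'Re (v 0 (enum_rank u)); pose b u := 'Im (v 0 (enum_rank u)).
  have ar u : a u \is Num.real by apply: Creal_Re.
  have br u : b u \is Num.real by apply: Creal_Im.
  have -> : sqnorm v = \sum_u a u ^+ 2 + \sum_u b u ^+ 2.
    rewrite /sqnorm reindex_enum_val -big_split; apply: eq_bigr => u _.
    exact: normC2_Re_Im.
  have -> : sqnorm (v *m adjmx e) = \sum_v (\sum_u a u * (E u v)%:R) ^+ 2
                                  + \sum_v (\sum_u b u * (E u v)%:R) ^+ 2.
    rewrite /sqnorm reindex_enum_val -big_split; apply: eq_bigr => u _.
    rewrite normC2_Re_Im mxE reindex_enum_val !raddf_sum /=.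
    congr (_ ^+ 2 + _ ^+ 2); apply: eq_bigr => z _; rewrite mxE /e !enum_rankK.
      by rewrite ReMr ?realn.
    by rewrite ImMr ?realn.
  by rewrite mulrDr lerD ?lo.
Qed.

(** * Numerical and sum-of-squares inequalities *)

Lemma sqrtC_natr_ge1 (n : nat) : (0 < n)%N -> 1 <= sqrtC n%:R :> algC.
Proof. by move=> n0; rewrite -(@expr_ge1 _ 2) ?sqrtC_ge0 ?ler0n // sqrtCK ler1n. Qed.

(** At [D = 2 d] the cubic inequality has slack [8 d ^ 3 - 4 > 0], because
    [(q - 1) (q ^ 2 + q + 1) = q ^ 3 - 1]; a slightly smaller [D] still satisfies it. As
    [(d - 1) ^ 2 = q - 2 d], the last inequality only says [D < 2 d]. *)
Lemma near_twice_sqrt (q : nat) (d := sqrtC (q.-1)%:R) : (1 < q)%N ->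
  exists D : algC, [/\ 0 < D,
    4%:R * q%:R ^+ 3 <= D ^+ 3 + (q%:R ^+ 2 + q%:R + 1) * D ^+ 2 &
    (d - 1) ^+ 2 < q%:R - D].
Proof.
move=> q1.
have qE : q%:R = d ^+ 2 + 1 :> algC by rewrite sqrtCK natr1 prednK // ltnW.
have d1 : 1 <= d by apply: sqrtC_natr_ge1; rewrite -ltnS prednK // ltnW.
have d0 : 0 < d := lt_le_trans ltr01 d1.
pose Q : algC := q%:R ^+ 3 + 1; have Q1 : 1 <= Q by rewrite lerDr exprn_ge0.
have Q0 : 0 < Q := lt_le_trans ltr01 Q1.
(* Chosen so that the term [4 (1 - 3 Q e)] of the expansion below vanishes. *)
pose e := (3%:R * Q)^-1.
have e0 : 0 < e by rewrite invr_gt0 mulr_gt0 ?ltr0n.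
have Qe : 3%:R * Q * e = 1 by rewrite mulfV // lt0r_neq0 // mulr_gt0 ?ltr0n.
have e1 : e < 1.
  rewrite invf_lt1 ?mulr_gt0 ?ltr0n //; apply: lt_le_trans (_ : 3%:R <= _).
    by rewrite ltr1n.
  by rewrite ler_peMr ?ler0n.
pose t := 1 - e; have t0 : 0 < t by rewrite subr_gt0.
exists (2%:R * d * t); split; first by rewrite !mulr_gt0 ?ltr0n.
  rewrite -subr_ge0.
  have -> : (2%:R * d * t) ^+ 3 + (q%:R ^+ 2 + q%:R + 1) * (2%:R * d * t) ^+ 2 - 4%:R * q%:R ^+ 3
     = 8%:R * (d ^+ 3 - 1) * t ^+ 3 + 4%:R * (q%:R ^+ 3 - 1) * t ^+ 2 * e
       + 4%:R * Q * e ^+ 2 * (2%:R + t)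
       + 4%:R * (1 - 3%:R * Q * e).
    by rewrite /t /Q qE; ring.
  rewrite Qe subrr mulr0 addr0.
  have q1' : 1 <= q%:R :> algC by rewrite ler1n ltnW.
  have d31 : 0 <= d ^+ 3 - 1 by rewrite subr_ge0 exprn_ege1.
  have q31 : 0 <= q%:R ^+ 3 - 1 :> algC by rewrite subr_ge0 exprn_ege1.
  have t2 : 0 <= 2%:R + t by rewrite addr_ge0 ?ler0n ?ltW.
  by rewrite !addr_ge0 // !mulr_ge0 ?exprn_ge0 ?ler0n ?(ltW t0) ?(ltW e0) ?(ltW Q0).
rewrite -subr_gt0.
have -> : q%:R - 2%:R * d * t - (d - 1) ^+ 2 = 2%:R * d * e by rewrite /t qE; ring.
by rewrite !mulr_gt0 ?ltr0n.
Qed.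

(** Cauchy-Schwarz against the constant vector, from the sum of all [(y i - y j) ^ 2]. *)
Lemma sum_sqr_le (I : finType) (y : I -> algC) : (forall i, y i \is Num.real) ->
  (\sum_i y i) ^+ 2 <= #|I|%:R * \sum_i y i ^+ 2.
Proof.
move=> yr.
have : 0 <= \sum_i \sum_j (y i - y j) ^+ 2.
  by do 2![apply: sumr_ge0 => ? _]; rewrite real_exprn_even_ge0 ?rpredB.
have -> : \sum_i \sum_j (y i - y j) ^+ 2 =
    2%:R * (#|I|%:R * \sum_i y i ^+ 2 - (\sum_i y i) ^+ 2).
  transitivity (\sum_i (#|I|%:R * y i ^+ 2 + \sum_j y j ^+ 2 - 2%:R * y i * \sum_j y j)).
    apply: eq_bigr => i _; rewrite mulr_sumr -sumrN mulr_natl -sumr_const -!big_split.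
    by apply: eq_bigr => j _ /=; ring.
  rewrite sumrB big_split /= -mulr_sumr sumr_const -!mulr_suml -mulr_sumr.
  by ring.
by rewrite pmulr_rge0 ?ltr0n // subr_ge0.
Qed.

(* With [c] minimised out and [t] as below, the difference of both sides is a
   sum of squares; the left-hand side telescopes along the cycles of the lift. *)
Lemma lower_step (q D a b c a' : algC)
    (t := D * (q ^+ 2 + D + 1) / (2%:R * q ^+ 2 + D)) :
  0 < q -> 0 < D -> 4%:R * q ^+ 3 <= D ^+ 3 + (q ^+ 2 + q + 1) * D ^+ 2 ->
  a \is Num.real -> b \is Num.real -> c \is Num.real -> a' \is Num.real ->
  (t - 1) * (a ^+ 2 - a' ^+ 2) <=
  D * (a ^+ 2 + b ^+ 2 / q + c ^+ 2 / q ^+ 2) + (a + b + c) ^+ 2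
    - (a + b) ^+ 2 + (a' + b) ^+ 2.
Proof.
move=> q0 D0 hD ar br cr a'r.
have qr := gtr0_real q0; have Dr := gtr0_real D0.
have e1 : 0 < q ^+ 2 + D by rewrite addr_gt0 ?exprn_gt0.
have e2 : 0 < q ^+ 2 + D + 1 by rewrite addr_gt0.
have e3 : 0 < 2%:R * q ^+ 2 + D by rewrite addr_gt0 ?mulr_gt0 ?exprn_gt0 ?ltr0n.
have t0 : 0 < t by rewrite /t divr_gt0 ?mulr_gt0.
have tr := gtr0_real t0.
rewrite -subr_ge0.
(* Squares are completed in [c], then in [a']; [t] is the value for which the terms in [a] form a
   square as well. What is left of [b ^ 2] has the cubic of the hypothesis as its numerator. *)
have -> : D * (a ^+ 2 + b ^+ 2 / q + c ^+ 2 / q ^+ 2) + (a + b + c) ^+ 2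
    - (a + b) ^+ 2 + (a' + b) ^+ 2 - (t - 1) * (a ^+ 2 - a' ^+ 2) =
   q ^+ 2 / (q ^+ 2 + D) / t * (t * a - b) ^+ 2 + t^-1 * (t * a' + b) ^+ 2
   + (D ^+ 3 + (q ^+ 2 + q + 1) * D ^+ 2 - 4%:R * q ^+ 3)
      / (q * D * (q ^+ 2 + D + 1)) * b ^+ 2
   + (c * (q ^+ 2 + D) + q ^+ 2 * (a + b)) ^+ 2 / (q ^+ 2 * (q ^+ 2 + D)).
  rewrite /t; field.
  by rewrite !lt0r_neq0.
have sq z : z \is Num.real -> 0 <= z ^+ 2 by move=> zr; rewrite real_exprn_even_ge0.
rewrite !addr_ge0 //.
- apply: mulr_ge0; last by apply/sq/realB => //; apply: realM.
  by apply: divr_ge0; [apply: divr_ge0; rewrite ?exprn_ge0 //|]; apply: ltW.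
- apply: mulr_ge0; last by apply/sq/realD => //; apply: realM.
  by rewrite invr_ge0 ltW.
- apply: mulr_ge0; last exact: sq.
  by rewrite divr_ge0 ?subr_ge0 // !mulr_ge0 // ltW.
- have q2r : q ^+ 2 \is Num.real by rewrite rpredX.
  apply: divr_ge0; last by rewrite mulr_ge0 ?exprn_ge0 ?ltW.
  by apply/sq/realD; apply: realM => //; apply: realD.
Qed.

(** * The projective plane over a finite field *)

Section Plane.
Variable F : finFieldType.
Local Notation q := #|F|.

(* Points and lines of the projective plane share the type [F * F + option F].
   The affine line [inl (m, b)] is [y = m x - b], with point at infinity
   [inr (Some m)]; the vertical line [x = c] is [inr (Some c)]; and [inr None] is
   the line at infinity as well as the vertical point at infinity. *)
Definition plane : finType := (F * F + option F)%type.

Definition inc (l p : plane) : bool :=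
  match l, p with
  | inl (m, b), inl (x, y) => y + b == m * x
  | inl (m, _), inr (Some c) => m == c
  | inr (Some c), inl (x, _) => c == x
  | inr (Some _), inr None | inr None, inr _ => true
  | _, _ => false
  end.

Definition infty : plane := inr None.

(** The minus sign in [y = m x - b] makes [y + b = m x] symmetric under exchanging [(m, b)] and
    [(x, y)]: the identity of [plane] is a polarity. *)
Lemma inc_sym l p : inc l p = inc p l.
Proof.
case: l p => [[m b]|[c|]] [[x y]|[c'|]]  //=; try exact: eq_sym.
by rewrite addrC mulrC.
Qed.

Lemma card_plane : #|plane| = (q ^ 2 + q + 1)%N.
Proof. by rewrite card_sum card_prod card_option addn1 addnS mulnn. Qed.

(** [option F] parametrises each line, [None] giving one point beyond a copy of [F]. *)
Lemma line_card l : #|inc l| = q.+1.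
Proof.
suff [f f_inj fE] : exists2 f : option F -> plane, injective f &
    forall p, inc l p = (p \in codom f).
  by rewrite (eq_card fE) card_codom // card_option.
case: l => [[m b]|[c|]].
- exists (fun o => if o is Some x then inl (x, m * x - b) else inr (Some m)).
    by move=> [x|] [y|] //= [->].
  move=> p; apply/idP/codomP.
    case: p => [[x y]|[c|]] //= /eqP E; last by exists None; rewrite E.
    by exists (Some x); rewrite -E addrK.
  by case=> [[x|]] -> /=; rewrite ?subrK.
- exists (fun o => if o is Some y then inl (c, y) else infty).
    by move=> [x|] [y|] //= [->].
  move=> p; apply/idP/codomP.
    case: p => [[x y]|[c'|]] //= E; last by exists None.
    by exists (Some y); rewrite (eqP E).
  by case=> [[x|]] -> /=.
- exists inr; first by move=> x y [].
  move=> p; apply/idP/codomP; first by case: p => // o _; exists o.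
  by case=> o ->.
Qed.

(** Parallel affine lines meet at the point of their slope, vertical lines at [infty]; two affine
    lines of distinct slopes meet where [m x - b = m' x - b']. *)
Lemma common_point l l' : l != l' -> exists p0, forall p, inc l p && inc l' p = (p == p0).
Proof.
have inlE (u v : F * F) : ((inl u : plane) == inl v) = (u == v) by [].
have inrE (u v : option F) : ((inr u : plane) == inr v) = (u == v) by [].
have SomeE (u v : F) : (Some u == Some v) = (u == v) by [].
case: l l' => [[m b]|[c|]] [[m' b']|[c'|]] //; rewrite ?inlE ?inrE ?SomeE => ne.
- have [Em|nm] := eqVneq m m'.
    exists (inr (Some m)) => -[[x y]|[c|]] //=.
    + apply/negbTE/negP => /andP[/eqP E1 /eqP E2]; case/negP: ne.
      rewrite Em xpair_eqE eqxx /=; apply/eqP/(addrI y).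
      by rewrite E1 E2 Em.
    + by rewrite -Em andbb inrE SomeE eq_sym.
  have nm' : m - m' != 0 by rewrite subr_eq0.
  pose x0 := (b - b') / (m - m'); exists (inl (x0, m * x0 - b)) => -[[x y]|[c|]] //=.
    rewrite inlE xpair_eqE; apply/andP/andP => [[/eqP E1 /eqP E2]|[/eqP -> /eqP ->]].
      have -> : x0 = x.
        have -> : x0 = ((y + b) - (y + b')) / (m - m') by rewrite /x0; congr (_ / _); ring.
        by rewrite E1 E2 -mulrBl mulrAC divff // mul1r.
      by rewrite -E1 addrK !eqxx.
    by rewrite subrK eqxx; split=> //; apply/eqP; rewrite /x0; field.
  apply/negbTE/negP => /andP[/eqP <- /eqP Em]; case/negP: nm.
  by rewrite Em.
- exists (inl (c', m * c' - b)) => -[[x y]|[c|]] //=; last by rewrite andbF.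
  rewrite inlE xpair_eqE; apply/andP/andP => [[/eqP E /eqP ->]|[/eqP -> /eqP ->]].
    by rewrite -E addrK !eqxx.
  by rewrite subrK !eqxx.
- exists (inr (Some m)) => -[[x y]|[c|]] //=; first by rewrite andbF.
  by rewrite andbT inrE SomeE eq_sym.
- exists (inl (c, m' * c - b')) => -[[x y]|[c'|]] //=.
  rewrite inlE xpair_eqE; apply/andP/andP => [[/eqP -> /eqP E]|[/eqP -> /eqP ->]].
    by rewrite -E addrK !eqxx.
  by rewrite subrK !eqxx.
- exists infty => -[[x y]|[c''|]] //=.
  by apply/negbTE/negP => /andP[/eqP Ec /eqP Ec']; case/negP: ne; rewrite Ec Ec'.
- by exists infty => -[[x y]|[c''|]] //=; rewrite andbF.
- exists (inr (Some m')) => -[[x y]|[c|]] //=.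
  by rewrite inrE SomeE eq_sym.
- by exists infty => -[[x y]|[c''|]].
Qed.

(** Entrywise form of [B B^T = q I + J] for the incidence matrix [B], with [J] the all-ones
    matrix. *)
Lemma line_gram l l' :
  \sum_p (inc l p)%:R * (inc l' p)%:R = 1 + q%:R * (l == l')%:R :> algC.
Proof.
under eq_bigr => p _ do rewrite -natrM mulnb.
have [<-|/common_point[p0 h]] := eqVneq l l'.
  under eq_bigr => p _ do rewrite andbb.
  by rewrite -natr_sum -big_mkcond sum1_card line_card mulr1 -addn1 natrD addrC.
under eq_bigr => p _ do rewrite h.
rewrite (bigD1 p0) //= eqxx big1 ?mulr0 //.
by move=> p /negPf ->.
Qed.

Lemma plane_form (y : plane -> algC) :
  \sum_p (\sum_l y l * (inc l p)%:R) ^+ 2 = q%:R * \sum_l y l ^+ 2 + (\sum_l y l) ^+ 2.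
Proof.
transitivity (\sum_l \sum_l' y l * y l' * \sum_p ((inc l p)%:R * (inc l' p)%:R)).
  rewrite (eq_bigr (fun p => \sum_l \sum_l' y l * y l' * ((inc l p)%:R * (inc l' p)%:R))).
    rewrite exchange_big; apply: eq_bigr => l _; rewrite exchange_big.
    by apply: eq_bigr => l' _; rewrite mulr_sumr.
  move=> p _; rewrite expr2 mulr_suml; apply: eq_bigr => l _.
  by rewrite mulr_sumr; apply: eq_bigr => l' _; rewrite mulrACA.
rewrite expr2 mulr_suml mulr_sumr -big_split; apply: eq_bigr => l _ /=.
under eq_bigr => l' _ do rewrite line_gram mulrDr mulr1.
rewrite big_split addrC mulr_sumr /=; congr (_ + _).
rewrite (bigD1 l) //= eqxx big1 ?addr0; first by rewrite mulr1 expr2 mulrC.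
by move=> l' /negPf; rewrite eq_sym => ->; rewrite !mulr0.
Qed.

Lemma big_plane (f : plane -> algC) :
  \sum_p f p = \sum_u f (inl u) + (\sum_c f (inr (Some c)) + f infty).
Proof.
rewrite big_sumType; congr (_ + _); rewrite (bigD1 None) //= addrC; congr (_ + _).
rewrite (reindex_onto Some (odflt 0)) => [|[d|]] //=.
by apply: eq_bigl => d; rewrite !eqxx.
Qed.

(** * Lifts of the incidence structure along a permutation of sheets *)

Section Lift.
Variables (J : finType) (pi pi' : J -> J).
Hypotheses (piK : cancel pi pi') (piK' : cancel pi' pi).

(* A voltage lift: only the flag [(infty, infty)] carries the nontrivial shift. *)
Definition lift_inc (s : J -> J) (u w : J * plane) : bool :=
  inc u.2 w.2 && (w.1 == if (u.2 == infty) && (w.2 == infty) then s u.1 else u.1).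

Lemma lift_inc_sym u w : lift_inc pi u w = lift_inc pi' w u.
Proof.
rewrite /lift_inc inc_sym [_ && (u.2 == _)]andbC; congr (_ && _).
case: ifP => _; last exact: eq_sym.
by apply/eqP/eqP => ->; rewrite ?piK ?piK'.
Qed.

Variable x : J * plane -> algC.
Let a j := x (j, infty).
Let b j := \sum_c x (j, inr (Some c)).
Let c j := \sum_u x (j, inl u).

(** All flags except [(infty, infty)] stay on their sheet, so only at the point [infty] is a term
    read elsewhere: [a (pi' j)] replaces [a j]. *)
Lemma lift_apply j p : \sum_u x u * (lift_inc pi u (j, p))%:R =
  \sum_l x (j, l) * (inc l p)%:R + (p == infty)%:R * (a (pi' j) - a j).
Proof.
transitivity (\sum_l \sum_j' x (j', l) * (lift_inc pi (j', l) (j, p))%:R).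
  rewrite exchange_big pair_bigA; apply: eq_bigr => -[j' l] _ //.
have point (g : J -> algC) j0 : \sum_j' g j' * (j0 == j')%:R = g j0.
  rewrite (bigD1 j0) //= eqxx mulr1 big1 ?addr0 // => j' /negPf.
  by rewrite eq_sym => ->; rewrite mulr0.
have summand l : \sum_j' x (j', l) * (lift_inc pi (j', l) (j, p))%:R =
   x (if (l == infty) && (p == infty) then pi' j else j, l) * (inc l p)%:R.
  rewrite -(point (fun j' => x (j', l) * (inc l p)%:R)); apply: eq_bigr => j' _.
  rewrite /lift_inc /= -mulrA -natrM mulnb; congr (_ * (_ && _)%:R).
  by case: ifP => // _; apply/eqP/eqP => [->|<-]; rewrite ?piK ?piK'.
under eq_bigr => l _ do rewrite summand.
rewrite (bigD1 infty) //= [in RHS](bigD1 infty) //=.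
rewrite (eq_bigr (fun l => x (j, l) * (inc l p)%:R)); last first.
  by move=> l /negPf ->.
rewrite [RHS]addrAC; congr (_ + _); rewrite /a.
case: eqP => [->|_] /=; last by rewrite mul0r addr0.
by rewrite mulr1 mulr1 mul1r addrC subrK.
Qed.

(** On each sheet [plane_form] applies, after which the square [(a + b) ^ 2] at the point [infty] is
    exchanged for [(a' + b) ^ 2]. *)
Lemma lift_form :
  \sum_w (\sum_u x u * (lift_inc pi u w)%:R) ^+ 2 =
  \sum_j (q%:R * (\sum_l x (j, l) ^+ 2) + (a j + b j + c j) ^+ 2
          - (a j + b j) ^+ 2 + (a (pi' j) + b j) ^+ 2).
Proof.
rewrite -(pair_bigA _ (fun j p => (\sum_u x u * (lift_inc pi u (j, p))%:R) ^+ 2)) /=.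
apply: eq_bigr => j _.
have S : \sum_l x (j, l) = a j + b j + c j.
  by rewrite big_plane [LHS]addrC [X in X + _]addrC.
rewrite -S -(plane_form (fun l => x (j, l))).
under eq_bigr => p _ do rewrite lift_apply.
have Sinf : \sum_l x (j, l) * (inc l infty)%:R = a j + b j.
  rewrite big_plane big1 => [|u _]; last by case: u => u v; rewrite mulr0.
  rewrite add0r mulr1 addrC; congr (_ + _).
  by apply: eq_bigr => d _; rewrite mulr1.
rewrite (bigD1 infty) //= [in RHS](bigD1 infty) //= Sinf mul1r.
rewrite (eq_bigr (fun p => (\sum_l x (j, l) * (inc l p)%:R) ^+ 2)); last first.
  by move=> p /negPf ->; rewrite mul0r addr0.
by ring.
Qed.

(** Cauchy-Schwarz on the [q] other lines through [infty] and on the [q ^ 2] affine lines reduces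
    each sheet to [lower_step]; the terms with [t - 1] cancel over all sheets because [pi'] permutes
    them. *)
Lemma lift_lower (D : algC) : (forall u, x u \is Num.real) -> 0 < D ->
  4%:R * q%:R ^+ 3 <= D ^+ 3 + (q%:R ^+ 2 + q%:R + 1) * D ^+ 2 ->
  (q%:R - D) * \sum_u x u ^+ 2 <= \sum_w (\sum_u x u * (lift_inc pi u w)%:R) ^+ 2.
Proof.
move=> xr D0 hD; rewrite lift_form.
have q0 : 0 < q%:R :> algC by rewrite ltr0n; apply/card_gt0P; exists 0.
have ar j : a j \is Num.real by apply: xr.
have br j : b j \is Num.real by apply: rpred_sum.
have cr j : c j \is Num.real by apply: rpred_sum.
set t := D * (q%:R ^+ 2 + D + 1) / (2%:R * q%:R ^+ 2 + D).
have tele : \sum_j (t - 1) * (a j ^+ 2 - a (pi' j) ^+ 2) = 0.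
  rewrite -mulr_sumr sumrB.
  have -> : \sum_j a (pi' j) ^+ 2 = \sum_j a j ^+ 2.
    by rewrite (reindex_inj (can_inj piK)); apply: eq_bigr => j _; rewrite piK.
  by rewrite subrr mulr0.
have -> : \sum_u x u ^+ 2 = \sum_j \sum_l x (j, l) ^+ 2.
  by rewrite pair_bigA; apply: eq_bigr => -[].
rewrite -[leLHS]addr0 -[X in _ + X <= _]tele.
rewrite mulr_sumr -big_split; apply: ler_sum => j _ /=.
have X_ge : a j ^+ 2 + b j ^+ 2 / q%:R + c j ^+ 2 / q%:R ^+ 2 <= \sum_l x (j, l) ^+ 2.
  rewrite big_plane [leRHS]addrC [X in _ <= X + _]addrC !lerD //.
    by rewrite ler_pdivrMr // mulrC; apply: sum_sqr_le.
  rewrite ler_pdivrMr ?exprn_gt0 // mulrC -natrX -mulnn -card_prod.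
  exact: sum_sqr_le.
have := lower_step q%:R D (a j) (b j) (c j) (a (pi' j)) q0 D0 hD (ar j) (br j) (cr j) (ar _).
rewrite -/t -(lerD2l ((q%:R - D) * \sum_l x (j, l) ^+ 2)) => /le_trans; apply.
have := ler_wpM2l (ltW D0) X_ge.
rewrite -subr_ge0 => h; rewrite -subr_ge0; move: h; congr (0 <= _).
by ring.
Qed.
End Lift.
Arguments lift_inc {J} s u w.

(* Test vector: it alternates in sign along the cycle [J]; given the values on [infty]
   and on [inr (Some _)], the value [- (s + s ^+ 2)] on the affine lines minimises
   the form minus its bound. *)
Lemma lift_upper (J : finType) (pi pi' : J -> J) (sg : J -> algC) (s : algC) :
  cancel pi pi' -> cancel pi' pi -> (0 < #|J|)%N ->
  (forall j, sg j \is Num.real) -> (forall j, sg j ^+ 2 = 1) ->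
  (forall j, sg (pi j) = - sg j) ->
  1 <= s -> s ^+ 2 = q%:R ->
  exists2 x : J * plane -> algC, forall u, x u \is Num.real &
    \sum_w (\sum_u x u * (lift_inc pi u w)%:R) ^+ 2
      < (q%:R + 1 - 2%:R * s) * \sum_u x u ^+ 2.
Proof.
move=> piK piK' J0 sgr sg2 sgN s1 sq.
have s0 : 0 < s := lt_le_trans ltr01 s1; have sr := gtr0_real s0.
(* The denominator [s ^ 4 + 2 s - 1] of the minimising affine value, cleared by scaling and grouped
   so that positivity is visible. *)
pose w := s ^+ 4 + s + (s - 1).
have w0 : 0 < w by rewrite ltr_wpDr ?subr_ge0 // addr_gt0 ?exprn_gt0.
have wr := gtr0_real w0.
(* The ratio [s] between the values at [infty] and [inr (Some _)] gives equality in
   [2 a b / s <= a ^ 2 + b ^ 2 / q]. *)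
pose y (l : plane) := match l with
  | inl _ => - (s + s ^+ 2) | inr (Some _) => w | inr None => s * w end.
exists (fun u => sg u.1 * y u.2) => [[j l]|].
  apply: realM => //; case: l => [?|[?|]] //=; last exact: realM.
  by rewrite realN realD // realX.
rewrite (lift_form J pi pi') //=.
have -> : \sum_u (sg u.1 * y u.2) ^+ 2 = \sum_j \sum_l (sg j * y l) ^+ 2.
  by rewrite pair_bigA; apply: eq_bigr => -[].
rewrite mulr_sumr.
have sum1 (z : algC) : \sum_(d : F) z = q%:R * z by rewrite sumr_const mulr_natl.
have sum2 (z : algC) : \sum_(u : F * F) z = q%:R ^+ 2 * z.
  by rewrite sumr_const card_prod mulnn -natrX mulr_natl.
have Y j : \sum_l (sg j * y l) ^+ 2 =
    q%:R ^+ 2 * (s + s ^+ 2) ^+ 2 + (q%:R * w ^+ 2 + (s * w) ^+ 2).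
  under eq_bigr => l _ do rewrite exprMn sg2 mul1r.
  by rewrite big_plane /= sum1 sum2 sqrrN.
have term j : q%:R * (\sum_l (sg j * y l) ^+ 2) +
   (sg j * (s * w) + \sum_(c0 : F) sg j * w + \sum_(u : F * F) sg j * - (s + s ^+ 2)) ^+ 2
   - (sg j * (s * w) + \sum_(c0 : F) sg j * w) ^+ 2
   + (sg (pi' j) * (s * w) + \sum_(c0 : F) sg j * w) ^+ 2
   < (q%:R + 1 - 2%:R * s) * \sum_l (sg j * y l) ^+ 2.
  have sg' : sg (pi' j) = - sg j by rewrite -[in RHS](piK' j) sgN opprK.
  rewrite Y sg' !sum1 sum2 -sq -subr_gt0.
  have := sg2 j; move: (sg j) => g g2.
  (* The second summand is a multiple of [1 - g ^ 2 = 0]; the first is positive because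
     [s ^ 2 = q >= 2]. *)
  have -> : (s ^+ 2 + 1 - 2%:R * s) * (s ^+ 2 ^+ 2 * (s + s ^+ 2) ^+ 2
       + (s ^+ 2 * w ^+ 2 + (s * w) ^+ 2))
     - (s ^+ 2 * (s ^+ 2 ^+ 2 * (s + s ^+ 2) ^+ 2 + (s ^+ 2 * w ^+ 2 + (s * w) ^+ 2))
        + (g * (s * w) + s ^+ 2 * (g * w) + s ^+ 2 ^+ 2 * (g * - (s + s ^+ 2))) ^+ 2
        - (g * (s * w) + s ^+ 2 * (g * w)) ^+ 2
        + (- g * (s * w) + s ^+ 2 * (g * w)) ^+ 2)
     = w * s ^+ 2 * ((s ^+ 2 - 2%:R) * (s ^+ 2 + (s - 1) ^+ 2) + 1)
     + (1 - g ^+ 2) * ((s * w + s ^+ 2 * w - s ^+ 2 * s ^+ 2 * (s + s ^+ 2)) ^+ 2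
        - (s * w + s ^+ 2 * w) ^+ 2 + (s ^+ 2 * w - s * w) ^+ 2).
    by rewrite /w; ring.
  rewrite g2 subrr mul0r addr0 mulr_gt0 ?mulr_gt0 ?exprn_gt0 //.
  rewrite ltr_wpDl ?ltr01 // mulr_ge0 //.
    by rewrite sq subr_ge0 ler_nat card_finNzRing_gt1.
  by apply: addr_ge0; rewrite real_exprn_even_ge0 // realB ?real1.
have /card_gt0P[j0 _] := J0.
rewrite [ltLHS](bigD1 j0) //= [ltRHS](bigD1 j0) //=.
by apply: ltr_leD; [exact: term | apply: ler_sum => j _; apply/ltW/term].
Qed.

(** * The bipartite incidence graph of the lift *)

Section CoverGraph.
Variables (J : finType) (pi pi' : J -> J).
Hypotheses (piK : cancel pi pi') (piK' : cancel pi' pi).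

(** [false] marks lines and [true] marks points. *)
Definition cover_edge (u v : bool * (J * plane)) : bool :=
  match u.1, v.1 with
  | false, true => lift_inc pi u.2 v.2
  | true, false => lift_inc pi v.2 u.2
  | _, _ => false
  end.

Lemma cover_edge_sym u v : cover_edge u v = cover_edge v u.
Proof. by case: u v => [[] u] [[] v]. Qed.

Lemma cover_edge_bip u v : cover_edge u v -> u.1 != v.1.
Proof. by case: u v => [[] u] [[] v]. Qed.

Lemma lift_inc_card (s : J -> J) u : #|[pred w | lift_inc s u w]| = q.+1.
Proof.
case: u => j l; rewrite -(line_card l).
pose f p := (if (l == infty) && (p == infty) then s j else j, p).
have f_inj : injective f by move=> p p' [].
rewrite -[RHS](card_imset _ f_inj); apply: eq_card => -[j' p].
rewrite !inE /lift_inc /=; apply/andP/imsetP => [[lp /eqP ->]|[p' lp [-> ->]]].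
  by exists p.
by split.
Qed.

Lemma cover_edge_card u : #|[pred v | cover_edge u v]| = q.+1.
Proof.
have pair_inj b : injective (pair b : J * plane -> bool * (J * plane)) by move=> ? ? [].
case: u => [[] u].
  rewrite -(lift_inc_card pi' u) -[RHS](card_imset _ (pair_inj false)).
  apply: eq_card => -[b w]; rewrite !inE /cover_edge /=; apply/idP/imsetP.
    by case: b => // h; exists w; rewrite // inE -(lift_inc_sym J pi pi' piK piK').
  by move=> [w' h [-> ->]]; rewrite (lift_inc_sym J pi pi' piK piK').
rewrite -(lift_inc_card pi u) -[RHS](card_imset _ (pair_inj true)).
apply: eq_card => -[b w]; rewrite !inE /cover_edge /=; apply/idP/imsetP.
  by case: b => // h; exists w.
by move=> [w' h [-> ->]].
Qed.

(** Each vertex reaches the line [infty] of its own sheet without using the shifted flag; the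
    shifted edge then leads from sheet [j] to sheet [pi j]. *)
Lemma cover_edge_connected :
  (forall i j, exists n, iter n pi i = j) -> forall u v, connect cover_edge u v.
Proof.
move=> trans; pose base j : bool * (J * plane) := (false, (j, infty)).
have csym : connect_sym cover_edge by apply: sym_connect_sym => u v; apply: cover_edge_sym.
have step u v w : cover_edge u v -> connect cover_edge v w -> connect cover_edge u w.
  by move=> /connect1; apply: connect_trans.
have edge (b : bool) j l p : inc l p -> (l != infty) || (p != infty) ->
    cover_edge (b, (j, l)) (~~ b, (j, p)).
  move=> lp; rewrite -negb_and => /negPf ne.
  case: b; rewrite /cover_edge /lift_inc /=; last by rewrite lp ne eqxx.
  by rewrite inc_sym lp [(p == _) && _]andbC ne eqxx.
have at_infty c j : connect cover_edge (true, (j, inr (Some c))) (base j).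
  by apply/connect1/edge.
(* The vertical line meets [infty] only at the point [infty], which the shift moves to another
   sheet, so the path goes through the affine line [y = 0]. *)
have slope c j : connect cover_edge (false, (j, inr (Some c))) (base j).
  apply: (step _ (true, (j, inl (c, 0)))); first by apply: edge => //=.
  apply: (step _ (false, (j, inl (0, 0)))); first by apply: edge => //=; rewrite addr0 mulr0.
  by apply: step (at_infty 0 j); apply: edge => //=.
have to_base u : connect cover_edge u (base u.2.1).
  case: u => [b [j l]] /=; case: b l => [] [[m y]|[c|]] //=.
  - by apply: step (slope m j); apply: edge => //=.
  - by apply: step (slope 0 j); apply: edge => //=.
  - by apply: step (at_infty m j); apply: edge => //=.
have shift j : connect cover_edge (base j) (base (pi j)).
  apply: (step _ (true, (pi j, infty))); last exact: to_base.
  by rewrite /cover_edge /lift_inc /= eqxx.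
have iterated n j : connect cover_edge (base j) (base (iter n pi j)).
  by elim: n => //= n IH; apply: connect_trans IH (shift _).
move=> u v; apply: connect_trans (to_base u) _.
have [n En] := trans u.2.1 v.2.1.
have := iterated n u.2.1; rewrite En => /connect_trans; apply.
by rewrite csym; apply: to_base.
Qed.

Lemma big_bool_pair (f : bool * (J * plane) -> algC) :
  \sum_v f v = \sum_w f (true, w) + \sum_w f (false, w).
Proof.
rewrite (eq_bigr (fun v => f (v.1, v.2))) => [|[]//].
by rewrite -(pair_bigA _ (fun b w => f (b, w))) /= big_bool.
Qed.

(** By the polarity, the transposed block is again a lift, along [pi'], so both blocks are covered
    by the same estimates. *)
Lemma cover_form (x : bool * (J * plane) -> algC) :
  \sum_v (\sum_u x u * (cover_edge u v)%:R) ^+ 2 =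
  \sum_w (\sum_u x (false, u) * (lift_inc pi u w)%:R) ^+ 2 +
  \sum_w (\sum_u x (true, u) * (lift_inc pi' u w)%:R) ^+ 2.
Proof.
rewrite big_bool_pair; congr (_ + _); apply: eq_bigr => w _; rewrite big_bool_pair.
  by rewrite [X in X + _]big1 ?add0r // => u _; rewrite mulr0.
rewrite [X in _ + X]big1 ?addr0 => [|u _]; last by rewrite mulr0.
by congr (_ ^+ 2); apply: eq_bigr => u _; rewrite /cover_edge /= (lift_inc_sym J pi pi' piK piK').
Qed.

Lemma cover_lower (D : algC) (x : bool * (J * plane) -> algC) :
  (forall u, x u \is Num.real) -> 0 < D ->
  4%:R * q%:R ^+ 3 <= D ^+ 3 + (q%:R ^+ 2 + q%:R + 1) * D ^+ 2 ->
  (q%:R - D) * \sum_u x u ^+ 2 <= \sum_v (\sum_u x u * (cover_edge u v)%:R) ^+ 2.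
Proof.
move=> xr D0 hD; rewrite cover_form big_bool_pair mulrDr addrC lerD //.
  exact: (lift_lower J pi pi').
exact: (lift_lower J pi' pi).
Qed.

Lemma cover_upper (sg : J -> algC) (s : algC) : (0 < #|J|)%N ->
  (forall j, sg j \is Num.real) -> (forall j, sg j ^+ 2 = 1) ->
  (forall j, sg (pi j) = - sg j) -> 1 <= s -> s ^+ 2 = q%:R ->
  exists2 x : bool * (J * plane) -> algC, forall u, x u \is Num.real &
    \sum_v (\sum_u x u * (cover_edge u v)%:R) ^+ 2
      < (q%:R + 1 - 2%:R * s) * \sum_u x u ^+ 2.
Proof.
move=> J0 sgr sg2 sgN s1 sq.
have [x xr hx] := lift_upper J pi pi' sg s piK piK' J0 sgr sg2 sgN s1 sq.
(* Support on the lines alone leaves a single block. *)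
exists (fun u => if u.1 then 0 else x u.2) => [[[] u]|] //=.
rewrite cover_form big_bool_pair /= [X in _ * (X + _)]big1 ?add0r => [|u _]; last first.
  by rewrite expr0n.
rewrite [X in _ + X]big1 ?addr0 // => u _.
by rewrite big1 ?expr0n // => w _; rewrite mul0r.
Qed.
End CoverGraph.
End Plane.

(** * The even cycle of sheets and the conclusion *)

Lemma iter_ordS n (i : 'I_n) k : iter k (@ordS n) i = ((i + k) %% n)%N :> nat.
Proof.
elim: k => [|k IH]; first by rewrite addn0 modn_small.
by rewrite iterS /= IH -addn1 modnDml addn1 addnS.
Qed.

Theorem theorem4p2 (k : nat) :
  prime_power k.-1 ->
  forall N : nat, exists (n : nat) (e : rel 'I_n),
    (N < n)%N /\ simple_graph e /\ connected_graph e /\ bipartite_graph e /\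
    regular_graph k e /\
    (exists s : seq algC, spectrum_of (adjmx e) s /\
       sqrtC (k.-2)%:R - 1 < HL_index n s /\ HL_index n s < sqrtC (k.-1)%:R - 1).
Proof.
move=> [p [m [pp m0 Ek]]] N.
have [F _ cF] := pPrimePowerField pp m0; rewrite -Ek in cF.
have q1 : (1 < #|F|)%N by apply: card_finNzRing_gt1.
(* Since [k.-1] is also [0] at [k = 0], that case is excluded by [1 < #|F|]. *)
have {}Ek : k = #|F|.+1 by rewrite cF prednK //; case: (k) cF q1 => // ->.
rewrite Ek /= {p m pp m0 Ek cF}.
(* Even length lets [(-1) ^ j] change sign at the wrap-around too; [L > N] makes the order exceed
   [N]. *)
pose L := (N.+1).*2; pose J : finType := 'I_L.
have piK : cancel (@ordS L) (@ord_pred L) := @ordSK L.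
have piK' : cancel (@ord_pred L) (@ordS L) := @ord_predK L.
pose V : finType := (bool * (J * plane F))%type.
pose M := (L * #|plane F|)%N.
have P0 : (0 < #|plane F|)%N by rewrite card_plane addn1.
have cV : #|V| = M.*2 by rewrite card_prod card_bool card_prod card_ord mul2n.
have M0 : (0 < M)%N by rewrite muln_gt0 P0.
pose s : algC := sqrtC #|F|%:R.
have s1 : 1 <= s := sqrtC_natr_ge1 _ (ltnW q1).
have sq : s ^+ 2 = #|F|%:R by rewrite sqrtCK.
have sr : s \is Num.real := gtr0_real (lt_le_trans ltr01 s1).
have [D [D0 hD dD]] := near_twice_sqrt #|F| q1.
pose sg (j : J) : algC := (-1) ^+ (val j).
have trans (i j : J) : exists n, iter n (@ordS L) i = j.
  exists (j + (L - i))%N; apply: val_inj; rewrite /= iter_ordS addnCA subnKC.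
    by rewrite modnDr modn_small.
  by rewrite ltnW.
have [e [simple_e conn_e bip_e reg_e [t [spec t0 lo hi]]]] :
    exists e : rel 'I_#|V|, [/\ simple_graph e, connected_graph e,
      bipartite_graph e, regular_graph #|F|.+1 e &
      exists t, [/\ spectrum_of (adjmx e) t, 0 <= HL_index #|V| t,
        #|F|%:R - D <= HL_index #|V| t ^+ 2 &
        HL_index #|V| t ^+ 2 < #|F|%:R + 1 - 2%:R * s]].
  apply: (graph_spectrum V (cover_edge F J (@ordS L)) fst _ M) => //.
  - exact: cover_edge_sym.
  - exact: cover_edge_bip.
  - exact: cover_edge_connected.
  - exact: (cover_edge_card F J _ _ piK piK').
  - by move=> x xr; apply: (cover_lower F J _ _ piK piK').
  - by rewrite !(realB, realD, realM, realn, real1).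
  - apply: (cover_upper F J _ _ piK piK' sg s) => //.
    + by rewrite card_ord.
    + by move=> j; rewrite realX ?realN ?real1.
    + by move=> j; rewrite sqrr_sign.
    + by move=> j; rewrite /sg /= -signr_odd odd_mod ?odd_double // signr_odd exprS mulN1r.
exists #|V|, e; split; last do 4![split=> //].
  rewrite cV -addnn (@leq_trans L) //; first by rewrite /L -addnn addSn ltnS leq_addr.
  by rewrite (@leq_trans M) ?leq_addr // leq_pmulr.
exists t; split=> //.
(* Both bounds compare squares of nonnegative numbers, which requires [sqrt (q - 1) >= 1] and
   [s >= 1]. *)
move: (HL_index _ t) t0 lo hi => h h0 lo hi; split.
  have d1 : 1 <= sqrtC #|F|.-1%:R :> algC.
    by apply: sqrtC_natr_ge1; rewrite -ltnS prednK // ltnW.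
  rewrite -(@ltr_pXn2r _ 2) ?nnegrE ?subr_ge0 //.
  exact: lt_le_trans dD lo.
rewrite -(@ltr_pXn2r _ 2) ?nnegrE ?subr_ge0 //.
suff -> : (s - 1) ^+ 2 = #|F|%:R + 1 - 2%:R * s by [].
by rewrite -sq; ring.
Qed.
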